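(* Let $(E,d)$ be a complete geodesic space with convex metric and let $f:E\to\mathbb{R}$ be continuous, convex, bounded below on bounded sets and satisfying one of the following: (i) $\inf_{x\in E}f(x)=-\infty$; or (ii) there exists $z_0\in E$ such that $f(z_0)=\inf_{x\in E}f(x)$ and every sequence $(x_n)_{n\in\mathbb{N}}$ in $E$ converges to $z_0$ if $f(x_n)\to f(z_0)$. Then the set \[\mathcal{W}_{min}=\left\{X\in P_{b,cl,cv}(E) : \min(X,f)\text{ is well-posed in the sense of Revalski}\right\}\] is a dense $G_\delta$-set in $P_{b,cl,cv}(E)$ (with respect to the Pompeiu-Hausdorff distance).
   Context: Let $(E,d)$ be a metric space. A geodesic path from $x$ to $y$ is a map $c:[0,l]\to E$ with $c(0)=x$, $c(l)=y$ and $d(c(t),c(t'))=|t-t'|$ for all $t,t'\in[0,l]$; its image is a geodesic segment joining $x$ and $y$. $E$ is a geodesic space if every two points are joined by a geodesic path. A subset is convex if every geodesic segment joining two of its points is contained in it. The metric of a geodesic space is convex if for any geodesic paths $c_1:[0,l_1]\to E$, $c_2:[0,l_2]\to E$ with $c_1(0)=c_2(0)$ one has $d(c_1(tl_1),c_2(tl_2))\le t\,d(c_1(l_1),c_2(l_2))$ for all $t\in[0,1]$. A function $f:E\to\mathbb{R}$ is convex if for every geodesic path $c:[0,l]\to E$ one has $f(c(tl))\le(1-t)f(c(0))+tf(c(l))$ for all $t\in[0,1]$. $P_{b,cl,cv}(E)$ is the family of nonempty, bounded, closed, convex subsets of $E$, with the Pompeiu-Hausdorff distance $h(X,Y)=\max\{\sup_{x\in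 X}\mathrm{dist}(x,Y),\sup_{y\in Y}\mathrm{dist}(y,X)\}$, where $\mathrm{dist}(z,X)=\inf_{x\in X}d(z,x)$. The problem $\min(X,f)$ consists in finding $x_0\in X$ with $f(x_0)=\inf\{f(x):x\in X\}$. For $\sigma>0$ let \[L_{X,f}(\sigma)=\left\{x\in E : f(x)\le\inf_{y\in X}f(y)+\sigma\text{ and }\mathrm{dist}(x,X)\le\sigma\right\}.\] The problem $\min(X,f)$ is well-posed in the sense of Revalski if $\inf_{\sigma>0}\mathrm{diam}\,L_{X,f}(\sigma)=0$. *)

(* Defs.v *)
From HB Require Import structures.
From mathcomp Require Import all_boot all_order all_algebra.
From mathcomp Require Import all_classical all_reals all_analysis.

Set Implicit Arguments.
Unset Strict Implicit.
Unset Printing Implicit Defensive.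
Import Order.TTheory GRing.Theory Num.Theory.
Import numFieldNormedType.Exports.

Local Open Scope classical_set_scope.
Local Open Scope ring_scope.

#[short(type="completeMetricType")]
HB.structure Definition CompleteMetric (K : numDomainType) :=
  { M of Complete M & Metric K M }.

Section geodesics.
Context {R : realType} {E : metricType R}.
Implicit Types (l t : R) (c : R -> E) (x y z : E) (X Y : set E) (f : E -> R).

(* A path [0, l] -> E is given by a total function R -> E, of which only the
   values on [0, l] matter. *)
Definition geodesic_path l c :=
  0 <= l /\ {in `[0, l] &, forall t t', mdist (c t) (c t') = `|t - t'|}.

Definition geodesic_path_from_to l c x y :=
  [/\ geodesic_path l c, c 0 = x & c l = y].

Definition geodesic_segment x y (S : set E) :=
  exists l c, geodesic_path_from_to l c x y /\ S = c @` `[0, l].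

Definition convex_subset X :=
  forall x y S, X x -> X y -> geodesic_segment x y S -> S `<=` X.

Definition convex_real_function f :=
  forall l c, geodesic_path l c -> forall t, 0 <= t <= 1 ->
    f (c (t * l)) <= (1 - t) * f (c 0) + t * f (c l).

Definition metric_bounded X :=
  exists M, forall x y, X x -> X y -> mdist x y <= M.

Definition bounded_below_on_bounded_sets f :=
  forall X, metric_bounded X -> has_lbound (f @` X).

(* Real-valued inf and sup: these are the usual ones for nonempty X (and, for
   the excess and the Pompeiu-Hausdorff distance, nonempty and bounded X, Y). *)
Definition dist_to z X : R := inf [set mdist z x | x in X].

Definition excess X Y : R := sup [set dist_to x Y | x in X].

Definition pompeiu_hausdorff X Y : R := Num.max (excess X Y) (excess Y X).

Definition diameter X : \bar R :=
  ereal_sup [set (mdist p.1 p.2)%:E | p in X `*` X].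

Definition sublevel_near X f (sigma : R) : set E :=
  [set x | ((f x)%:E <= ereal_inf [set (f y)%:E | y in X] + sigma%:E)%E /\
           dist_to x X <= sigma].

Definition revalski_well_posed X f :=
  ereal_inf [set diameter (sublevel_near X f sigma) | sigma in [set s | 0 < s]]
  = 0%E.

End geodesics.

Definition geodesic_space {R : realType} (E : metricType R) :=
  forall x y : E, exists l c, geodesic_path_from_to l c x y.

Definition convex_metric {R : realType} (E : metricType R) :=
  forall (l1 l2 : R) (c1 c2 : R -> E),
    geodesic_path l1 c1 -> geodesic_path l2 c2 -> c1 0 = c2 0 ->
    forall t, 0 <= t <= 1 ->
      mdist (c1 (t * l1)) (c2 (t * l2)) <= t * mdist (c1 l1) (c2 l2).

Record Pbclcv {R : realType} (E : metricType R) := MkPbclcv {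
  Pbclcv_set :> set E ;
  Pbclcv_nonempty : Pbclcv_set !=set0 ;
  Pbclcv_bounded : metric_bounded Pbclcv_set ;
  Pbclcv_closed : closed Pbclcv_set ;
  Pbclcv_convex : convex_subset Pbclcv_set }.

Section hausdorff_metric.
Context {R : realType} {E : metricType R}.
Implicit Types (x y z : E) (X Y Z : Pbclcv E).

HB.instance Definition _ := gen_eqMixin (Pbclcv E).
HB.instance Definition _ := gen_choiceMixin (Pbclcv E).

Lemma Pbclcv_inj X Y : X = Y :> set E -> X = Y.
Proof.
case: X Y => [X a b c d] [Y a' b' c' d'] /= XY; subst Y.
by congr MkPbclcv; exact: Prop_irrelevance.
Qed.

Lemma dist_to_le z x (A : set E) : A x -> dist_to z A <= mdist z x.
Proof.
move=> Ax; apply: ge_inf; last by exists x.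
by exists 0 => _ [y _ <-]; exact: mdist_ge0.
Qed.

Lemma le_dist_to z (A : set E) (r : R) : A !=set0 ->
  (forall x, A x -> r <= mdist z x) -> r <= dist_to z A.
Proof.
move=> [a Aa] rA; apply: lb_le_inf; first by exists (mdist z a), a.
by move=> _ [x Ax <-]; exact: rA.
Qed.

Lemma dist_to_ge0 z X : 0 <= dist_to z X.
Proof.
by apply: le_dist_to => [|x _]; [exact: Pbclcv_nonempty|exact: mdist_ge0].
Qed.

Lemma dist_to_triangle z w X : dist_to z X <= mdist z w + dist_to w X.
Proof.
rewrite -lerBlDl; apply: le_dist_to => [|x Xx]; first exact: Pbclcv_nonempty.
by rewrite lerBlDl (le_trans (dist_to_le z Xx))// metric_triangle.
Qed.

Lemma dist_to_le_excess x X Y : Pbclcv_set X x -> dist_to x Y <= excess X Y.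
Proof.
move=> Xx; apply: ub_le_sup; last by exists x.
have [M XM] := Pbclcv_bounded X; exists (M + dist_to x Y) => _ [z Xz <-].
by rewrite (le_trans (dist_to_triangle z x Y))// lerD2r XM.
Qed.

Lemma excess_le X Y (r : R) :
  (forall x, Pbclcv_set X x -> dist_to x Y <= r) -> excess X Y <= r.
Proof.
move=> Xr; apply: ge_sup.
  by have [x Xx] := Pbclcv_nonempty X; exists (dist_to x Y), x.
by move=> _ [x Xx <-]; exact: Xr.
Qed.

Lemma excess_ge0 X Y : 0 <= excess X Y.
Proof.
have [x Xx] := Pbclcv_nonempty X.
exact: le_trans (dist_to_ge0 x Y) (dist_to_le_excess Y Xx).
Qed.

Lemma excess_triangle Y X Z : excess X Z <= excess X Y + excess Y Z.
Proof.
apply: excess_le => x Xx.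
apply: (@le_trans _ _ (dist_to x Y + excess Y Z)); last first.
  by rewrite lerD2r dist_to_le_excess.
rewrite -lerBlDr; apply: le_dist_to => [|y Yy]; first exact: Pbclcv_nonempty.
rewrite lerBlDr (le_trans (dist_to_triangle x y Z))// lerD2l.
exact: dist_to_le_excess.
Qed.

Lemma excess_sub X Y : excess X Y <= 0 -> X `<=` Y.
Proof.
move=> XY0 x Xx; apply: Pbclcv_closed => B /nbhs_ballP[e /= e0 eB].
apply: contrapT => YB.
suff : e <= dist_to x Y.
  by rewrite leNgt (le_lt_trans (dist_to_le_excess Y Xx) (le_lt_trans XY0 e0)).
apply: le_dist_to => [|y Yy]; first exact: Pbclcv_nonempty.
rewrite leNgt; apply/negP => xye; apply: YB; exists y; split => //.
by apply: eB; rewrite ballEmdist.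
Qed.

Lemma pompeiu_hausdorffxx X : pompeiu_hausdorff X X = 0.
Proof.
rewrite /pompeiu_hausdorff maxxx; apply/eqP; rewrite eq_le excess_ge0 andbT.
by apply: excess_le => x Xx; rewrite (le_trans (dist_to_le x Xx))// mdistxx.
Qed.

Lemma pompeiu_hausdorff_eq0 X Y : pompeiu_hausdorff X Y = 0 -> X = Y.
Proof.
move=> XY0; have : pompeiu_hausdorff X Y <= 0 by rewrite XY0.
rewrite /pompeiu_hausdorff ge_max => /andP[XY YX].
by apply: Pbclcv_inj; apply/seteqP; split; exact: excess_sub.
Qed.

Lemma pompeiu_hausdorffC X Y : pompeiu_hausdorff X Y = pompeiu_hausdorff Y X.
Proof. by rewrite /pompeiu_hausdorff maxC. Qed.

Lemma pompeiu_hausdorff_triangle Y X Z :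
  pompeiu_hausdorff X Z <= pompeiu_hausdorff X Y + pompeiu_hausdorff Y Z.
Proof.
rewrite {1}/pompeiu_hausdorff ge_max; apply/andP; split.
  by rewrite (le_trans (excess_triangle Y X Z))// lerD// le_max lexx.
rewrite (le_trans (excess_triangle Y Z X))// addrC.
by rewrite lerD// le_max lexx orbT.
Qed.

HB.instance Definition _ := @isMetric.Build R (Pbclcv E)
  (fun X Y => pompeiu_hausdorff X Y) pompeiu_hausdorffxx pompeiu_hausdorff_eq0
  pompeiu_hausdorffC pompeiu_hausdorff_triangle.

End hausdorff_metric.

Definition W_min {R : realType} (E : metricType R) (f : E -> R) :
    set (Pbclcv E) :=
  [set X | revalski_well_posed X f].

(* Main.v *)
(** Well-posedness of [X] means that for each [e] some [L_(X,f)(s)] has diameter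
  at most [e], a condition on [X] that is open for the Pompeiu-Hausdorff
  distance by continuity of [f]; hence the G_delta part.

  For density, let [N_r] be the closed [r]-neighbourhood of [X]. If [f] has the
  same infimum over [E] and over [N_(e/2)], then (i) is excluded and (ii) makes
  [N_(e/2)] itself well-posed. Otherwise there are [m] and [p] with
  [f p < m < inf f(N_(e/2))] such that [A = {f <= m}] meets [N_e]. Since [A]
  stays at distance [e/2] from [X], there is a uniform [K] with
  [d(x,a) <= K dist(a,X)] for all [x] in [X] and [a] in both [A] and [N_e], so
  that
    [Y = {x : d(x,a) + K dist(x,X) <= K dist(a,X)}]
  is a closed convex set containing [X] and [a], contained in [N_e] (it replaces
  the drop, i.e. the closed convex hull of [X] and [a]). Taking for [a] an
  Ekeland point of [dist(.,X)] on [A] with parameter [1/(2K)], every [y] in [Y]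
  satisfies [d(y,a) <= (2K+1) dist(y,A)], and convexity of [f] turns this into
  well-posedness of [Y]. *)

Require Import Defs.
From HB Require Import structures.
From mathcomp Require Import all_boot all_order all_algebra.
From mathcomp Require Import all_classical all_reals all_analysis.
From mathcomp Require Import borel_hierarchy.
From mathcomp Require Import ring lra.
Set Implicit Arguments.
Unset Strict Implicit.
Unset Printing Implicit Defensive.
Import Order.TTheory GRing.Theory Num.Theory.
Import numFieldNormedType.Exports.
Local Open Scope classical_set_scope.
Local Open Scope ring_scope.

(** * Continuity of distance functions, and Ekeland's variational principle *)

Section metric_facts.
Context {R : realType} {E : metricType R}.
Implicit Types (x y z a : E) (X : Pbclcv E) (g h : E -> R).

Lemma dist_to_lt_ex z (A : set E) (r : R) : A !=set0 -> dist_to z A < r ->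
  exists2 x, A x & mdist z x < r.
Proof.
move=> [x Ax] /inf_lt; case; first by exists (mdist z x), x.
by move=> _ [y Ay <-]; exists y.
Qed.

Lemma dist_to_eq0 z X : (X : set E) z -> dist_to z X = 0.
Proof.
move=> Xz; apply/eqP; rewrite eq_le dist_to_ge0 andbT.
by rewrite (le_trans (dist_to_le z Xz))// mdistxx.
Qed.

Lemma lipschitz_mdist_continuous (K : R) g :
  (forall x y, g x <= g y + K * mdist x y) -> continuous g.
Proof.
move=> gK x; apply/cvgrPdist_le => e e0; near=> y.
(* The sign of [K] is free; [|K| + 1] is a positive bound for it. *)
have xy : mdist x y < e / (`|K| + 1).
  near: y; apply/nbhs_ballP; exists (e / (`|K| + 1)) => /=.
    by rewrite divr_gt0// ltr_wpDl.
  by move=> y; rewrite ballEmdist.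
have Kxy : K * mdist x y <= e.
  move: xy; rewrite ltr_pdivlMr; last by rewrite ltr_wpDl.
  have := mdist_ge0 x y; have := ler_norm K.
  by move: (mdist x y) => m; nra.
have := gK x y; have := gK y x; rewrite (metric_sym y x) ler_distlC.
by move=> ? ?; apply/andP; split; lra.
Unshelve. all: by end_near. Qed.

Lemma continuous_mdistl a : continuous (fun x => mdist x a).
Proof.
apply: (@lipschitz_mdist_continuous 1) => x y.
by rewrite mul1r addrC metric_triangle.
Qed.

Lemma continuous_dist_to X : continuous (fun x => dist_to x X).
Proof.
apply: (@lipschitz_mdist_continuous 1) => x y.
by rewrite mul1r addrC dist_to_triangle.
Qed.

Lemma closed_sublevel g (r : R) :
  continuous g -> closed [set x | g x <= r].
Proof.
move=> cg; apply: (@closed_comp _ _ g [set t : R | t <= r]).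
  by move=> x _; exact: cg.
exact: closed_le.
Qed.

End metric_facts.

(* The sets [S x] of points that beat [x] by
   at least [lambda] times their distance to [x] are nested along a
   quasi-minimizing sequence and their diameters tend to 0. *)
Lemma ekeland {R : realType} {E : completeMetricType R} (A : set E)
    (phi : E -> R) (lambda : R) (x0 : E) :
  0 < lambda -> closed A -> continuous phi -> (forall x, 0 <= phi x) -> A x0 ->
  exists a, [/\ A a, phi a <= phi x0 &
    forall x, A x -> phi a <= phi x + lambda * mdist a x].
Proof.
move=> l0 cA cphi phi0 Ax0.
pose S x := A `&` [set y | phi y + lambda * mdist y x <= phi x].
have Srefl x : A x -> S x x.
  by move=> Ax; split=> //=; rewrite mdistxx mulr0 addr0.
have Strans x y z : S x y -> S y z -> S x z.
  move=> [_ /= xy] [Az /= yz]; split => //=.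
  have : mdist z x <= mdist z y + mdist y x by exact: metric_triangle.
  by nra.
have Sclosed x : closed (S x).
  apply: closedI => //; apply: closed_sublevel => z.
  apply: cvgD; first exact: cphi.
  by apply: cvgM; [exact: cvg_cst|exact: continuous_mdistl].
(* [nxt (k, x)] minimizes [phi] on [S x] up to [1/(k+1)]. The premise [A p.2] makes the relation
   total, so that choice applies. *)
have [|nxt nxtP] := @choice _ _ (fun (p : nat * E) y => A p.2 ->
    S p.2 y /\ forall z, S p.2 z -> phi y <= phi z + p.1.+1%:R^-1).
  move=> [k x] /=; have [Ax|nAx] := pselect (A x); last by exists x.
  have phiS : has_inf (phi @` S x).
    split; first by exists (phi x), x; [exact: Srefl|].
    by exists 0 => _ [y _ <-].
  have k0 : 0 < k.+1%:R^-1 :> R by rewrite invr_gt0.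
  have [_ [y Sy <-] yinf] := inf_adherent k0 phiS.
  exists y => _; split => // z Sz; apply: (le_trans (ltW yinf)).
  by rewrite lerD2r; apply: ge_inf; [case: phiS|exists z].
pose u := fix u n := if n is k.+1 then nxt (k, u k) else x0.
have Au n : A (u n) by elim: n => //= n /(nxtP (n, u n)) [[]].
have uS n m : S (u n) (u (n + m)%N).
  elim: m => [|m IH]; first by rewrite addn0; exact: Srefl.
  rewrite addnS; apply: Strans IH _.
  exact: (nxtP ((n + m)%N, u (n + m)%N) (Au _)).1.
have uD n z : S (u n.+1) z -> mdist z (u n.+1) <= n.+1%:R^-1 / lambda.
  (* By transitivity [z] lies in [S (u n)], where [phi] can drop below [phi (u n.+1)] by at most
     [1/(n+1)]; membership in [S (u n.+1)] forces a drop of at least [lambda] times the distance. *)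
  move=> Sz; have [Sn /(_ z)] := nxtP (n, u n) (Au n).
  move=> /(_ (Strans _ _ _ Sn Sz)); rewrite ler_pdivlMr//=.
  case: Sz => _ /=; set m := mdist _ _; set q := _^-1.
  by set p := phi (nxt _); lra.
have small (e : R) : 0 < e -> exists n : nat, n.+1%:R^-1 / lambda < e.
  move=> e0; have el : 0 < e * lambda by rewrite mulr_gt0.
  near \oo => n; exists n; rewrite ltr_pdivrMr//.
  by near: n; exact: near_infty_natSinv_lt (PosNum el).
have cvgu : cvg (u @ \oo).
  apply/cauchy_cvgP; apply: cauchy_exP => e e0.
  have [n ne] := small _ e0; exists (u n.+1); exists n.+1 => //= m nm.
  rewrite ballEmdist/= metric_sym (le_lt_trans _ ne)//; apply: uD.
  by rewrite -(subnKC nm).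
have aS n : S (u n) (lim (u @ \oo)).
  apply: (closed_cvg (S (u n)) (Sclosed _) _ _ cvgu); exists n => //= m nm.
  by rewrite -(subnKC nm).
exists (lim (u @ \oo)); set a := lim _ in aS *.
have [Aa a0] := aS 0%N; split => //.
  by apply: le_trans a0; rewrite lerDl mulr_ge0 ?mdist_ge0// ltW.
move=> x Ax; rewrite leNgt; apply/negP => xa.
have Sax : S a x by split => //=; rewrite metric_sym ltW.
(* Both [a] and [x] lie in every [S (u n)], and these sets shrink to a point. *)
suff ax : mdist x a <= 0.
  have ax0 : mdist a x = 0.
    by apply/eqP; rewrite metric_sym eq_le ax mdist_ge0.
  by move: xa; rewrite -(mdist_positivity _ _ ax0) mdistxx mulr0 addr0 ltxx.
apply/ler_addgt0Pl => e e0; rewrite addr0.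
have [n ne] := small (e / 2) (divr_gt0 e0 (ltr0Sn _ 1)).
have := uD _ _ (aS n.+1); have := uD _ _ (Strans _ _ _ (aS n.+1) Sax).
have : mdist x a <= mdist x (u n.+1) + mdist a (u n.+1).
  by rewrite (metric_sym a) metric_triangle.
move: (u n.+1) ne => v; set q := _ / lambda.
by move: (mdist x a) (mdist x v) (mdist a v) => dxa dxv dav; lra.
Unshelve. all: by end_near. Qed.

(** * Convexity along geodesics *)

Section geodesic_facts.
Context {R : realType} {E : metricType R}.
Implicit Types (x y z a : E) (X : Pbclcv E) (g h : E -> R).
Implicit Types (l t : R) (c : R -> E).

Lemma geodesic_path_rev l c :
  geodesic_path l c -> geodesic_path l (fun s => c (l - s)).
Proof.
move=> [l0 cl]; split => // t t'; rewrite !in_itv/= => tl t'l.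
rewrite cl ?in_itv/=; [|lra|lra].
have -> : l - t - (l - t') = t' - t by ring.
exact: distrC.
Qed.

Lemma geodesic_path_cst a : geodesic_path 0 (fun=> a).
Proof.
split => // t t'; rewrite !in_itv/= -!eq_le => /eqP <- /eqP <-.
by rewrite mdistxx subrr normr0.
Qed.

Lemma geodesic_mdist l c t : geodesic_path l c -> 0 <= t <= 1 ->
  mdist (c 0) (c (t * l)) = t * l.
Proof.
move=> [l0 cl] /andP[t0 t1]; rewrite cl ?in_itv/= ?lexx//; last first.
  by rewrite mulr_ge0//= ler_piMl.
by rewrite sub0r normrN ger0_norm// mulr_ge0.
Qed.

Lemma geodesic_length l c : geodesic_path l c -> mdist (c 0) (c l) = l.
Proof.
by move=> cl; rewrite -{1}(mul1r l) (geodesic_mdist cl) ?mul1r// ler01 lexx.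
Qed.

Lemma convex_real_sublevel g (r : R) :
  convex_real_function g -> convex_subset [set x | g x <= r].
Proof.
move=> cg x y S /= gx gy [l [c [[lc c0x cly] ->]]] _ [s + <-] /=.
rewrite /= in_itv/= => /andP[s0 sl].
have [t t01 ->] : exists2 t, 0 <= t <= 1 & s = t * l.
  have [l0|l0] := eqVneq l 0.
    exists 0; rewrite ?lexx ?ler01// mul0r; apply/eqP.
    by rewrite eq_le s0 -l0 sl.
  have l1 : 0 < l by rewrite lt0r l0 (le_trans s0).
  exists (s / l); last by rewrite divfK.
  by rewrite divr_ge0 ?(ltW l1)//= ler_pdivrMr// mul1r.
have := cg _ _ lc _ t01; rewrite c0x cly; case/andP: t01; nra.
Qed.

Lemma convex_real_combination g h (k : R) : 0 <= k ->
  convex_real_function g -> convex_real_function h ->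
  convex_real_function (fun x => g x + k * h x).
Proof.
move=> k0 cg ch l c lc t t01.
have := cg _ _ lc _ t01; have := ler_wpM2l k0 (ch _ _ lc _ t01).
by rewrite mulrDr; lra.
Qed.

Hypotheses (gE : geodesic_space E) (cE : convex_metric E).

(* Both geodesics are compared with the diagonal one from [c1 0] to [c2 l2]. *)
Lemma mdist_geodesics_convex l1 l2 (c1 c2 : R -> E) t :
  geodesic_path l1 c1 -> geodesic_path l2 c2 -> 0 <= t <= 1 ->
  mdist (c1 (t * l1)) (c2 (t * l2)) <=
    (1 - t) * mdist (c1 0) (c2 0) + t * mdist (c1 l1) (c2 l2).
Proof.
move=> gc1 gc2 t01; have [l3 [c3 [gc3 c30 c3l]]] := gE (c1 0) (c2 l2).
have := cE gc1 gc3 (esym c30) t01; rewrite c3l.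
have := cE (geodesic_path_rev gc3) (geodesic_path_rev gc2).
rewrite !subr0 c3l => /(_ erefl (1 - t)).
have e l : l - (1 - t) * l = t * l by ring.
rewrite !e !subrr c30 => /(_ ltac:(lra)) h23 h13.
apply: (le_trans (metric_triangle _ (c3 (t * l3)) _)).
by rewrite addrC lerD.
Qed.

Lemma convex_mdist a : convex_real_function (fun x => mdist x a).
Proof.
move=> l c lc t t01.
exact: (mdist_geodesics_convex lc (geodesic_path_cst a) t01).
Qed.

(** Choose points [u], [v] of [X] almost nearest to the endpoints. The geodesic from [u] to [v]
    stays in the convex set [X], and the distance between the two geodesics at equal proportion is
    convex. *)
Lemma convex_dist_to X : convex_real_function (fun x => dist_to x X).
Proof.
move=> l c lc t t01; apply/ler_addgt0Pr => e e0.
have X0 := Pbclcv_nonempty X.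
have near z : exists2 x, (X : set E) x & mdist z x < dist_to z X + e.
  by apply: dist_to_lt_ex => //; rewrite ltrDl.
have [u Xu cu] := near (c 0); have [v Xv cv] := near (c l).
have [l' [c' [lc' c'0 c'l]]] := gE u v.
have Xc' : (X : set E) (c' (t * l')).
  apply: (@Pbclcv_convex _ _ X u v (c' @` `[0, l'])) => //.
    by exists l', c'.
  exists (t * l') => //; case: lc' t01 => l'0 _ /andP[t0 t1].
  by rewrite /= in_itv/= mulr_ge0//= ler_piMl.
apply: (le_trans (dist_to_le _ Xc')).
apply: (le_trans (mdist_geodesics_convex lc lc' t01)).
case/andP: t01 => t0 t1; have t1' : 0 <= 1 - t by rewrite subr_ge0.
have := ler_wpM2l t1' (ltW cu); have := ler_wpM2l t0 (ltW cv).
by rewrite c'0 c'l; lra.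
Qed.

End geodesic_facts.

(** * Estimates for the Pompeiu-Hausdorff distance *)

Section hausdorff_facts.
Context {R : realType} {E : metricType R}.
Implicit Types (x y : E) (X Y : Pbclcv E) (r : R).

Lemma pompeiu_hausdorff_lt_ex X Y r x :
  pompeiu_hausdorff X Y < r -> (X : set E) x ->
  exists2 y, (Y : set E) y & mdist x y < r.
Proof.
rewrite /pompeiu_hausdorff gt_max => /andP[XYr _] Xx.
apply: dist_to_lt_ex; first exact: Pbclcv_nonempty.
exact: le_lt_trans (dist_to_le_excess Y Xx) XYr.
Qed.

Lemma dist_to_le_hausdorff X Y x :
  dist_to x X <= dist_to x Y + pompeiu_hausdorff X Y.
Proof.
rewrite -lerBlDr; apply: le_dist_to => [|y Yy]; first exact: Pbclcv_nonempty.
rewrite lerBlDr (le_trans (dist_to_triangle x y X))// lerD2l.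
by rewrite (le_trans (dist_to_le_excess X Yy))// le_max lexx orbT.
Qed.

Lemma pompeiu_hausdorff_sub_le X Y r : 0 <= r -> (X : set E) `<=` Y ->
  (forall y, (Y : set E) y -> dist_to y X <= r) -> pompeiu_hausdorff X Y <= r.
Proof.
move=> r0 XY YX; rewrite /pompeiu_hausdorff ge_max; apply/andP; split.
  by apply: excess_le => x /XY Yx; rewrite dist_to_eq0.
exact: excess_le.
Qed.

End hausdorff_facts.

(** * Well-posedness through small sublevel sets, and the G_delta part *)

Section well_posedness.
Context {R : realType} {E : metricType R} (f : E -> R).
Hypothesis fb : bounded_below_on_bounded_sets f.
Implicit Types (x y : E) (X Y : Pbclcv E) (e s : R).

Lemma has_inf_image X : has_inf (f @` X).
Proof.
split; last exact: fb (Pbclcv_bounded X).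
by have [x Xx] := Pbclcv_nonempty X; exists (f x), x.
Qed.

Lemma inf_image_le X x : (X : set E) x -> inf (f @` X) <= f x.
Proof. by move=> Xx; apply: ge_inf; [case: (has_inf_image X)|exists x]. Qed.

Lemma inf_image_lt_ex X s : inf (f @` X) < s ->
  exists2 x, (X : set E) x & f x < s.
Proof.
by move=> /(inf_lt (has_inf_image X).1)[_ [x Xx <-] fxs]; exists x.
Qed.

Lemma sublevel_nearP X s x : sublevel_near X f s x <->
  f x <= inf (f @` X) + s /\ dist_to x X <= s.
Proof.
rewrite /sublevel_near /=.
have -> : [set (f y)%:E | y in X] = EFin @` (f @` X) by rewrite -image_comp.
have [fX0 fXlb] := has_inf_image X.
by rewrite ereal_inf_EFin// -EFinD lee_fin.
Qed.

Definition small_sublevel_near e X :=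
  exists2 s, 0 < s & forall x y,
    sublevel_near X f s x -> sublevel_near X f s y -> mdist x y <= e.

Lemma revalski_well_posedP X :
  revalski_well_posed X f <-> forall e, 0 < e -> small_sublevel_near e X.
Proof.
split=> [X0 e e0|Xsmall].
  have /ereal_inf_lt[_ [s s0 <-] se] : (ereal_inf
      [set diameter (sublevel_near X f s) | s in [set s | 0 < s]%R] < e%:E)%E.
    by rewrite X0 lte_fin.
  exists s => // x y Lx Ly; rewrite -lee_fin (le_trans _ (ltW se))//.
  by apply: ereal_sup_ubound; exists (x, y).
apply/eqP; rewrite eq_le; apply/andP; split.
  apply/lee_addgt0Pr => e e0; rewrite add0e; have [s s0 Ls] := Xsmall e e0.
  apply: (@le_trans _ _ (diameter (sublevel_near X f s))).
    by apply: ereal_inf_lbound; exists s.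
  by apply: ge_ereal_sup => _ [[x y] /= [Lx Ly] <-]; rewrite lee_fin Ls.
(* The diameter of the empty set is [-oo], so nonnegativity requires a point in each sublevel set: a
   near-minimizer in [X]. *)
apply: le_ereal_inf_tmp => _ [s /= s0 <-].
have [x Xx xs] : exists2 x, (X : set E) x & f x < inf (f @` X) + s.
  by apply: inf_image_lt_ex; rewrite ltrDl.
apply: ereal_sup_ubound; exists (x, x); last by rewrite mdistxx.
by split => /=; apply/sublevel_nearP; rewrite dist_to_eq0//; split; exact: ltW.
Qed.

(** For [Y] close to [X], L_(Y,f)(s/2) lies in L_(X,f)(s): a near-minimizer of [f] on [X] has a
    neighbour in [Y] with almost the same value, so the infimum over [Y] exceeds that over [X] by at
    most [s / 2]. *)
Lemma open_small_sublevel_near e :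
  continuous f -> open [set X | small_sublevel_near e X].
Proof.
move=> cf; rewrite openE => X [s s0 Ls].
have s20 : 0 < s / 2 by rewrite divr_gt0.
have s40 : 0 < s / 4 by rewrite divr_gt0.
have [x Xx xs] : exists2 x, (X : set E) x & f x < inf (f @` X) + s / 4.
  by apply: inf_image_lt_ex; rewrite ltrDl.
have /nbhs_ballP[r /= r0 xr] : \forall y \near x, f y < f x + s / 4.
  have /cvgrPdist_lt/(_ _ s40) := cf x; apply: filterS => y.
  by rewrite ltr_distlC => /andP[].
apply/nbhs_ballP; exists (Num.min r (s / 2)) => /=; first by rewrite lt_min r0.
move=> Y; rewrite ballEmdist /= lt_min => /andP[XYr XYs].
have [y Yy xy] := pompeiu_hausdorff_lt_ex XYr Xx.
have fy : f y < f x + s / 4 by apply: xr; rewrite ballEmdist.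
have YX : inf (f @` Y) <= inf (f @` X) + s / 2.
  by apply: (le_trans (inf_image_le Yy)); lra.
have sub z : sublevel_near Y f (s / 2) z -> sublevel_near X f s z.
  move=> /sublevel_nearP[fz dz]; apply/sublevel_nearP; split; first by lra.
  have XYs' : pompeiu_hausdorff X Y < s / 2 := XYs.
  by have := dist_to_le_hausdorff X Y z; lra.
by exists (s / 2) => // z w /sub Lz /sub Lw; exact: Ls.
Qed.

Lemma Gdelta_W_min : continuous f -> Gdelta (W_min f).
Proof.
move=> cf; exists (fun n => [set X | small_sublevel_near n.+1%:R^-1 X]) => [n|].
  exact: open_small_sublevel_near.
apply/seteqP; split => X.
  by move=> /revalski_well_posedP XW n _; apply: XW; rewrite invr_gt0.
move=> XW; apply/revalski_well_posedP => e e0.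
have [n ne] : exists n : nat, n.+1%:R^-1 < e.
  near \oo => n; exists n; near: n; exact: near_infty_natSinv_lt (PosNum e0).
have [s s0 Ls] := XW n I; exists s => // x y Lx Ly.
by rewrite (le_trans (Ls _ _ Lx Ly))// ltW.
Unshelve. all: by end_near. Qed.

(** The last hypothesis puts L_(X,f)(s) inside {f <= f z + s}. These sets shrink to [z], since
    otherwise a minimizing sequence would stay away from [z]. *)
Lemma strong_min_well_posed X z : (forall x, f z <= f x) ->
  (forall u : nat -> E,
    f (u n) @[n --> \oo] --> f z -> u n @[n --> \oo] --> z) ->
  inf (f @` X) <= f z -> revalski_well_posed X f.
Proof.
move=> zmin zstrong Xz; apply/revalski_well_posedP => e e0.
have e20 : 0 < e / 2 by rewrite divr_gt0.
suff [s s0 near_z] : exists2 s, 0 < s &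
    forall x, f x <= f z + s -> mdist x z <= e / 2.
  exists s => // x y /sublevel_nearP[fx _] /sublevel_nearP[fy _].
  rewrite (splitr e) (le_trans (metric_triangle _ z _))// (metric_sym z).
  by apply: lerD; apply: near_z; lra.
apply: contrapT => /forall2NP nonear.
have [n|u uP] := @choice _ _ (fun (n : nat) x =>
    f x <= f z + n.+1%:R^-1 /\ e / 2 < mdist x z).
  case: (nonear n.+1%:R^-1) => [|/existsNP[x /not_implyP[fx /negP]]].
    by rewrite invr_gt0.
  by rewrite -ltNge => xz; exists x.
have /zstrong uz : f (u n) @[n --> \oo] --> f z.
  apply: (@squeeze_cvgr _ _ _ _ (fun=> f z) (fun n => f z + n.+1%:R^-1)).
  - by apply: nearW => n; rewrite zmin (uP n).1.
  - exact: cvg_cst.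
  - rewrite -[X in _ --> X]addr0; apply: cvgD; first exact: cvg_cst.
    exact: cvg_harmonic.
have [n _ /(_ n (leqnn n)) /=] := metricType_numDomainType.cvgr_dist_lt uz e20.
by rewrite metric_sym ltNge (ltW (uP n).2).
Qed.

End well_posedness.

Lemma metric_bounded_neighbourhood {R : realType} {E : metricType R}
    (X : Pbclcv E) (r : R) : metric_bounded [set x | dist_to x X <= r].
Proof.
have [M XM] := Pbclcv_bounded X; exists (M + 2 * (r + 1)) => x y /= xr yr.
have near z : dist_to z X <= r -> exists2 u, (X : set E) u & mdist z u < r + 1.
  by move=> zr; apply: dist_to_lt_ex; [exact: Pbclcv_nonempty|lra].
have [u Xu xu] := near x xr; have [v Xv yv] := near y yr.
have := metric_triangle x u y; have := metric_triangle u v y.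
have := XM u v Xu Xv.
by rewrite (metric_sym v y); lra.
Qed.

(** * Density: a well-posed set near any given one *)

Section density.
Context {R : realType} {E : completeMetricType R} (f : E -> R).
Hypotheses (gE : geodesic_space E) (cE : convex_metric E).
Hypotheses (cf : continuous f) (vf : convex_real_function f).
Hypothesis fb : bounded_below_on_bounded_sets f.
Implicit Types (x y a p : E) (X Y : Pbclcv E) (e r m : R).

Lemma neighbourhood_Pbclcv X r : 0 <= r ->
  exists Y : Pbclcv E, (Y : set E) = [set x | dist_to x X <= r].
Proof.
move=> r0.
unshelve eexists (@MkPbclcv _ _ [set x | dist_to x X <= r] _ _ _ _) => //.
- by have [x Xx] := Pbclcv_nonempty X; exists x; rewrite /= dist_to_eq0.
- exact: metric_bounded_neighbourhood.
- by apply: closed_sublevel; exact: continuous_dist_to.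
- by apply: convex_real_sublevel; exact: convex_dist_to.
Qed.

(* A point at level [m + s] enters the sublevel set [f <= m] after a move of
   order [s] towards [p]. *)
Lemma sharp_well_posed Y a p m (C : R) : 0 <= C -> (Y : set E) a ->
  f a <= m -> f p < m ->
  (forall x y, f x <= m -> (Y : set E) y -> mdist y a <= C * mdist y x) ->
  revalski_well_posed Y f.
Proof.
move=> C0 Ya fam fpm Ysharp; apply/(revalski_well_posedP fb) => e e0.
have [M YM] := Pbclcv_bounded Y.
have M0 : 0 <= M by rewrite -(mdistxx a) YM.
pose c := m - f p; have c0 : 0 < c by rewrite subr_gt0.
(* [D] bounds the distance to [p] from any point less than 2 away from [Y]. *)
pose D := M + 2 + mdist a p.
have D0 : 0 < D by have := mdist_ge0 a p; rewrite /D; lra.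
have Dc0 : 0 < D / c by rewrite divr_gt0.
(* Chosen so that the final estimate reads [mdist x a <= s * Q]. *)
pose Q := 2 + C * (2 + D / c).
have Q0 : 0 < Q by rewrite /Q; nra.
pose s := Num.min 1 (e / 2 / Q).
have s0 : 0 < s by rewrite lt_min ltr01 !divr_gt0.
have s1 : s <= 1 by rewrite ge_min lexx.
have sQ : s * Q <= e / 2 by rewrite -ler_pdivlMr// ge_min lexx orbT.
suff near_a x : sublevel_near Y f s x -> mdist x a <= e / 2.
  exists s => // x y Lx Ly.
  rewrite (splitr e) (le_trans (metric_triangle _ a _))// (metric_sym a).
  by apply: lerD; exact: near_a.
move=> /(sublevel_nearP fb)[fx dx].
have [y Yy xy] : exists2 y, (Y : set E) y & mdist x y < 2 * s.
  by apply: dist_to_lt_ex; [exists a|lra].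
have fxm : f x <= m + s by have := inf_image_le fb Ya; lra.
have xp : mdist x p <= D.
  have := metric_triangle x y p; have := metric_triangle y a p.
  by have := YM y a Yy Ya; rewrite /D; lra.
have [l [g [lg g0 gl]]] := gE x p.
have lE : l = mdist x p by rewrite -g0 -gl geodesic_length.
(* [t] solves [(1 - t) * (m + s) + t * f p = m]. *)
pose t := s / (s + c); have sc0 : 0 < s + c by rewrite addr_gt0.
have t0 : 0 <= t by rewrite divr_ge0 ?(ltW s0) ?(ltW sc0).
have t1 : t <= 1 by rewrite ler_pdivrMr// mul1r lerDl ltW.
have tsc : t * (s + c) = s by rewrite divfK// gt_eqF.
have t01 : 0 <= t <= 1 by rewrite t0.
have fz : f (g (t * l)) <= m.
  apply: (le_trans (vf lg t01)); rewrite g0 gl.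
  have h : (1 - t) * f x <= (1 - t) * (m + s) by rewrite ler_wpM2l// subr_ge0.
  by apply: (le_trans (lerD h (lexx _))); move: tsc; rewrite /c; lra.
have xz : mdist x (g (t * l)) <= s * (D / c).
  rewrite -{1}g0 (geodesic_mdist lg t01) lE.
  have -> : s * (D / c) = s / c * D by ring.
  apply: ler_pM => //; first exact: mdist_ge0.
  by rewrite ler_pM2l// lef_pV2 ?posrE// lerDr ltW.
have yz : mdist y (g (t * l)) <= s * (2 + D / c).
  have := metric_triangle y x (g (t * l)); rewrite (metric_sym y x); lra.
have ya := Ysharp _ _ fz Yy.
have := metric_triangle x y a; have := ler_wpM2l C0 yz.
by move: sQ; rewrite /Q; lra.
Qed.

Lemma ex_well_posed_of_lower_point X e p m : 0 < e ->
  (forall x, dist_to x X <= e / 2 -> m <= f x) -> f p < m ->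
  (exists2 x, dist_to x X <= e & f x < m) ->
  exists2 Y : Pbclcv E, revalski_well_posed Y f & pompeiu_hausdorff X Y <= e.
Proof.
move=> e0 mle pm [x0 x0e x0m].
(* The level must lie strictly above [f p] for sharpness, and strictly below [m] to keep its
   sublevel set away from [X]. *)
pose m' := (Num.max (f x0) (f p) + m) / 2.
have [x0m' pm' m'm] : [/\ f x0 <= m', f p < m' & m' < m].
  rewrite /m'; have : Num.max (f x0) (f p) < m by rewrite gt_max x0m.
  have : f x0 <= Num.max (f x0) (f p) by rewrite le_max lexx.
  have : f p <= Num.max (f x0) (f p) by rewrite le_max lexx orbT.
  by split; lra.
have [M0 NM0] := metric_bounded_neighbourhood X e.
pose M := `|M0| + 1; have Mgt0 : 0 < M by rewrite ltr_wpDl.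
have NM x y : dist_to x X <= e -> dist_to y X <= e -> mdist x y <= M.
  move=> xe ye; rewrite (le_trans (NM0 _ _ xe ye))// (le_trans (ler_norm _))//.
  by rewrite lerDl.
have e20 : 0 < e / 2 by rewrite divr_gt0.
(* As [dist_to a X] will exceed [e / 2], [K * dist_to a X] exceeds the diameter bound [M]; hence [X]
   will lie in [G]. *)
pose K := M / (e / 2); have K0 : 0 < K by rewrite divr_gt0.
have l0 : 0 < (2 * K)^-1 by rewrite invr_gt0 mulr_gt0.
have [a [am' ax0 aek]] := ekeland l0 (closed_sublevel (r := m') cf)
  (@continuous_dist_to _ _ X) (fun x => dist_to_ge0 x X) x0m'.
have ae : dist_to a X <= e by exact: le_trans ax0 x0e.
have a_far : e / 2 < dist_to a X.
  by rewrite ltNge; apply/negP => /mle; move: am' => /=; lra.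
pose G := [set x | mdist x a + K * dist_to x X <= K * dist_to a X].
have Ga : G a by rewrite /G/= mdistxx add0r.
have XG : (X : set E) `<=` G.
  move=> x Xx; rewrite /G/= dist_to_eq0// mulr0 addr0.
  have -> : K * dist_to a X = M * (dist_to a X / (e / 2)).
    by rewrite /K mulrAC mulrA.
  apply: (le_trans (NM x a _ ae)); first by rewrite dist_to_eq0// ltW.
  by rewrite ler_peMr ?(ltW Mgt0)// ler_pdivlMr// mul1r ltW.
have Ge x : G x -> dist_to x X <= e.
  rewrite /G/= => Gx; apply: le_trans ae; rewrite -(ler_pM2l K0).
  by apply: le_trans Gx; rewrite lerDr mdist_ge0.
have GM : metric_bounded G by exists M => x y /Ge xe /Ge ye; exact: NM.
have Gcl : closed G.
  apply: closed_sublevel => x; apply: cvgD; first exact: continuous_mdistl.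
  by apply: cvgM; [exact: cvg_cst|exact: continuous_dist_to].
have Gcv : convex_subset G.
  apply: convex_real_sublevel; apply: convex_real_combination; first exact: ltW.
    exact: convex_mdist.
  exact: convex_dist_to.
exists (MkPbclcv (ex_intro _ a Ga) GM Gcl Gcv); last first.
  by apply: pompeiu_hausdorff_sub_le => //; exact: ltW.
apply: (@sharp_well_posed _ a p m' (2 * K + 1)) => //.
  by rewrite addr_ge0// mulr_ge0// ltW.
move=> x y fx; rewrite /= /G /= => Gy.
(* With [Gy], this gives [mdist y a <= K * mdist x y + mdist a x / 2]; half of [mdist y a] is then
   absorbed on the left, whence the constant [2 * K + 1]. *)
have := ler_wpM2l (ltW K0) (aek x fx).
have KlK : K * (2 * K)^-1 = 2^-1 by rewrite invfM mulrCA mulfV ?mulr1// gt_eqF.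
rewrite mulrDr mulrA KlK.
have := ler_wpM2l (ltW K0) (dist_to_triangle x y X).
have := metric_triangle a y x; rewrite (metric_sym a y) (metric_sym x y).
move: Gy; move: (mdist y a) (mdist y x) (mdist a x) => ya yx ax.
by move: (dist_to x X) (dist_to y X) (dist_to a X) => dx dy da; lra.
Qed.

(** A near-minimizer of [f] on [X] drops below the infimum when moved a small proportion [t] towards
    [p]. *)
Lemma ex_lower_near X r m p : 0 < r -> m = inf (f @` X) -> f p < m ->
  exists2 x, dist_to x X <= r & f x < m.
Proof.
move=> r0 mE pm; have [M XM] := Pbclcv_bounded X.
have [x1 Xx1] := Pbclcv_nonempty X.
pose D := M + mdist x1 p + 1.
have M0 : 0 <= M by rewrite -(mdistxx x1) XM.
have D0 : 0 < D by have := mdist_ge0 x1 p; rewrite /D; lra.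
pose t := Num.min 1 (r / D).
have t0 : 0 < t by rewrite lt_min ltr01 divr_gt0.
have t1 : t <= 1 by rewrite ge_min lexx.
have tD : t * D <= r by rewrite -ler_pdivlMr// ge_min lexx orbT.
have t01 : 0 <= t <= 1 by rewrite ltW.
(* With this tolerance, convexity bounds the value after the move by [m - t ^ 2 * (m - f p)]. *)
have [x Xx fx] : exists2 x, (X : set E) x & f x < m + t * (m - f p).
  by apply: (inf_image_lt_ex fb); rewrite -mE ltrDl mulr_gt0// subr_gt0.
have [l [g [lg g0 gl]]] := gE x p.
exists (g (t * l)).
  rewrite (le_trans (dist_to_le _ Xx))// metric_sym -g0 (geodesic_mdist lg t01).
  apply: le_trans tD; rewrite ler_pM2l// -(geodesic_length lg) g0 gl.
  have := metric_triangle x x1 p; have := XM x x1 Xx Xx1; rewrite /D; lra.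
have mx : m <= f x by rewrite mE; exact: inf_image_le.
by apply: (le_lt_trans (vf lg t01)); rewrite g0 gl; nra.
Qed.

End density.
Theorem theorem5p5 (R : realType) (E : completeMetricType R) (f : E -> R) :
  geodesic_space E ->
  convex_metric E ->
  continuous f ->
  convex_real_function f ->
  bounded_below_on_bounded_sets f ->
  (ereal_inf (range (fun x : E => (f x)%:E)) = -oo%E \/
   exists z0 : E,
     (f z0)%:E = ereal_inf (range (fun x : E => (f x)%:E)) /\
     forall x : nat -> E,
       f (x n) @[n --> \oo] --> f z0 -> x n @[n --> \oo] --> z0) ->
  dense (W_min f) /\ Gdelta (W_min f).
Proof.
move=> gE cE cf vf fb finf; split; last exact: Gdelta_W_min.
move=> O [X OX]; rewrite openE => /(_ X OX)/nbhs_ballP[r /= r0 XrO].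
suff [Y YW XYr] : exists2 Y : Pbclcv E,
    revalski_well_posed Y f & pompeiu_hausdorff X Y <= r / 2.
  exists Y; split => //; apply: XrO; rewrite ballEmdist /=.
  by apply: le_lt_trans XYr _; rewrite ltr_pdivrMr// ltr_pMr// ltr1n.
have r20 : 0 < r / 2 by rewrite divr_gt0.
have r40 : 0 < r / 2 / 2 by rewrite divr_gt0.
have [Y0 Y0E] := neighbourhood_Pbclcv gE cE X (ltW r40).
have XY0 : pompeiu_hausdorff X Y0 <= r / 2 / 2.
  apply: pompeiu_hausdorff_sub_le => [|x Xx|y]; rewrite ?Y0E //=.
    exact: ltW.
  by rewrite dist_to_eq0// ltW.
have mle x : dist_to x X <= r / 2 / 2 -> inf (f @` Y0) <= f x.
  by move=> xr; apply: inf_image_le; rewrite ?Y0E.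
have [[p pm]|noP] := pselect (exists p, f p < inf (f @` Y0)).
  apply: (ex_well_posed_of_lower_point gE cE cf vf fb r20 mle pm).
  (* A point within [r / 4] of [Y0] is within [r / 2] of [X]. *)
  have [x xY0 xm] := ex_lower_near gE vf fb r40 erefl pm; exists x => //.
  by have := dist_to_le_hausdorff X Y0 x; lra.
(* The infimum over [Y0] is now global: this contradicts (i), and under (ii) [Y0] itself serves. *)
have fge x : inf (f @` Y0) <= f x.
  by rewrite leNgt; apply/negP => ?; apply: noP; exists x.
case: finf => [finfN|[z0 [z0min z0strong]]].
  have /ereal_inf_lt[_ [x _ <-]] :
      (ereal_inf (range (fun x => (f x)%:E)) < (inf (f @` Y0))%:E)%E.
    by rewrite finfN ltNyr.
  by rewrite lte_fin ltNge fge.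
exists Y0; last by lra.
apply: (strong_min_well_posed fb (z := z0)) => // x.
by rewrite -lee_fin z0min; apply: ereal_inf_lbound; exists x.
Qed.
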